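(* Let $\ell\ge 2$ and suppose that $K$ is a $(q, k, \lambda)$-difference set of $\mathbb{F}_q$. Let $M = \left[ (i + q', j) \right]_{0 \leq i, j \leq \ell-1}$ and let $S = \left[ (i + q', j) \right]_{1 \leq i, j \leq \ell-1}$ be the submatrix obtained from $M$ by deleting the row and the column indexed by $0$. Then $$\mathrm{Spec}(M) = \left\{\tfrac{k + \sqrt{k^2 - 4 \lambda}}{2},\ \tfrac{k - \sqrt{k^2 - 4 \lambda}}{2},\ \sqrt{k - \lambda}^{\left(\frac{\ell}{2}-1\right)},\ -\sqrt{k - \lambda}^{\left(\frac{\ell}{2}-1\right)} \right\}$$ and $$\mathrm{Spec}(S) = \left\{k - \lambda,\ \sqrt{k - \lambda}^{\left(\frac{\ell}{2}-1\right)},\ -\sqrt{k - \lambda}^{\left(\frac{\ell}{2}-1\right)} \right\},$$ where the eigenvectors of $M$ and $S$ corresponding to $\pm \sqrt{k - \lambda}$ are of the form $(0, w)$ and $w$, respectively, for some vector $w \in \mathbb{R}^{\ell-1}$ whose entries sum to zero. Moreover, the minimal polynomials of $M$ and $S$ are $$(x^2 - k x + \lambda) (x^2 - (k - \lambda)) \quad \text{and} \quad (x - (k - \lambda)) (x^2 - (k - \lambda)),$$ respectively.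
   Context: Let $q$ be a power of an odd prime, $\ell$ a divisor of $q-1$, $g$ a fixed generator of $\mathbb{F}_q^{*}$, $K$ the subgroup of $\mathbb{F}_q^*$ consisting of all $\ell$-th powers of nonzero elements, $k=|K|=\frac{q-1}{\ell}$, and $q'=\frac{q-1}{2}$. For integers $i,j$ the cyclotomic number is $(i,j) = \left| (1 + g^i K) \cap g^j K \right|$, which depends only on $i,j$ modulo $\ell$. $K$ is a $(q,k,\lambda)$-difference set if $\lambda$ is a positive integer such that every nonzero element of $\mathbb{F}_q$ can be written as $x-y$ with $(x,y)\in K\times K$ in exactly $\lambda$ ways (when $\ell\ge2$ this forces $\ell$ to be even and $\lambda=\frac{k-1}{\ell}$). The notation $\mathrm{Spec}(T)=\{a_1^{(n_1)},a_2^{(n_2)},\ldots\}$ means that the $a_i$ are the distinct eigenvalues of $T$ and the $n_i$ are their multiplicities; $a^{(1)}$ is written simply $a$.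
   Formalization: For ℓ = 2 the printed minimal polynomials are impossible (M is 2×2, S is 1×1; e.g. q = 7, k = 3, λ = 1); they are proved as printed for ℓ > 2, and for ℓ = 2 the factor x² − (k − λ) is dropped, giving x² − kx + λ and x − (k − λ). *)

(* Defs.v *)
From HB Require Import structures.
From mathcomp Require Import all_boot all_order all_fingroup all_algebra.
From mathcomp Require Import all_solvable.
From mathcomp Require Import complex.

Set Implicit Arguments.
Unset Strict Implicit.
Unset Printing Implicit Defensive.

Import Order.TTheory GRing.Theory Num.Theory.
Local Open Scope ring_scope.
Local Open Scope complex_scope.

Definition powK (F : finFieldType) (ell : nat) : {set F} :=
  [set x ^+ ell | x : F & x != 0].

Definition cyclotomic_number (F : finFieldType) (ell : nat) (g : F)
    (i j : int) : nat :=
  #|[set 1 + g ^ i * x | x in powK F ell] :&: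
    [set g ^ j * x | x in powK F ell]|.

(* The number v of points of a (v, k, lambda)-difference set is #|V|. *)
Definition difference_set (V : finZmodType) (D : {set V}) (k lambda : nat) :=
  [/\ #|D| = k, (0 < lambda)%N &
      forall d : V, d != 0 ->
        #|[set p in setX D D | p.1 - p.2 == d]| = lambda].

Definition cyclotomic_mx (R : pzRingType) (F : finFieldType) (ell : nat)
    (g : F) : 'M[R]_ell :=
  \matrix_(i, j)
    (cyclotomic_number ell g ((i : nat)%:Z + ((#|F|.-1)./2)%:Z)
                             (j : nat)%:Z)%:R.

(* The real matrix T is viewed over R[i], so that [s] has to account for all of
   its complex eigenvalues; multiplicities are algebraic.  An entry (a, 0) of
   [s] asserts that a is not an eigenvalue of T. *)
Definition has_spectrum (R : rcfType) (n : nat) (T : 'M[R]_n)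
    (s : seq (R[i] * nat)) : Prop :=
  let TC := map_mx (real_complex R) T in
  [/\ uniq (unzip1 s),
      forall a, eigenvalue TC a -> a \in unzip1 s &
      forall a m, (a, m) \in s -> mup a (char_poly TC) = m].

(* Column eigenvectors, whereas [eigenvalue] uses the action on rows. *)
Definition is_eigenvector (R : fieldType) (n : nat) (T : 'M[R]_n) (a : R)
    (v : 'cV[R]_n) : Prop :=
  v != 0 /\ T *m v = a *: v.

(* Main.v *)
(** Since g^q' = -1, the entry M_ij counts the pairs (a, b) with a in g^i K,
b in g^j K and a + b = 1; so M is symmetric.  Scaling by K turns the
difference-set property into M_0j = lambda, M 1 = k 1 - e_0 and
M^2 = (k - lambda) I + lambda k J - k E_00, whence
S^2 = (k - lambda) (I + lambda J) and S 1 = (k - lambda) 1.  These identities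
make M and S annihilated by the two polynomials of the statement, which have
distinct roots, so both matrices are diagonalizable.  The trace of
q(M), for q the cofactor of a root a, gives the multiplicity of a.
The multiplicities of rho and -rho are then settled by tr M = k - b, with b = 1
if -1 is in K and b = 0 otherwise: their difference times rho is -b, and
rho^2 = k - lambda > 1 excludes b = 1. *)

Require Import Defs.
From HB Require Import structures.
From mathcomp Require Import all_boot all_order all_fingroup all_algebra.
From mathcomp Require Import all_solvable.
From mathcomp Require Import complex ring lra zify.

Set Implicit Arguments.
Unset Strict Implicit.
Unset Printing Implicit Defensive.

Import Order.TTheory GRing.Theory Num.Theory.
Local Open Scope ring_scope.
Local Open Scope complex_scope.

(** * Matrices annihilated by a polynomial with distinct roots in the base field *)

Lemma char_poly_conj (R : comUnitRingType) (n : nat) (P A : 'M[R]_n) :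
  P \in unitmx -> char_poly (invmx P *m A *m P) = char_poly A.
Proof.
move=> Pu; rewrite /char_poly /char_poly_mx.
have PK : map_mx polyC (invmx P) *m map_mx polyC P = 1%:M.
  by rewrite -map_mxM mulVmx // map_mx1.
rewrite !map_mxM -[X in X - _]mulmx1 -PK mulmxA -scalar_mxC -!mulmxA -mulmxBr.
by rewrite -mulmxBl !det_mulmx mulrCA -[\det (map_mx _ (invmx P)) * _]det_mulmx PK det1 mulr1.
Qed.

(** The list [s] is the diagonal of a diagonal matrix similar to [A]. The trace formula, taken at
    well-chosen [p], later yields equations for the multiplicities. *)
Lemma diagonalizable_roots (R : fieldType) (n : nat) (A : 'M[R]_n.+1)
    (rs : seq R) :
  uniq rs -> horner_mx A (\prod_(r <- rs) ('X - r%:P)) = 0 ->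
  exists2 s : seq R, {subset s <= rs} &
    char_poly A = \prod_(r <- s) ('X - r%:P) /\
    forall p, \tr (horner_mx A p) = \sum_(r <- s) p.[r].
Proof.
move=> rs_uniq rsA0.
have [P Pu /(diagonalizable_forLR Pu)[d AE]] : diagonalizable A.
  by apply/diagonalizableP; exists rs => //; apply: mxminpoly_min.
have {}AE : A = invmx P *m diag_mx d *m P by rewrite AE; apply: conjVmx.
have charA : char_poly A = \prod_(r <- map (d 0) (enum 'I_n.+1)) ('X - r%:P).
  rewrite big_map big_enum /=.
  transitivity (char_poly (diag_mx d)); last first.
    rewrite char_poly_trig ?diag_mx_is_trig //.
    by apply: eq_bigr => i _; rewrite mxE eqxx.
  by rewrite AE char_poly_conj.
exists (map (d 0) (enum 'I_n.+1)).
  move=> r; rewrite -root_prod_XsubC -charA -root_mxminpoly -root_prod_XsubC.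
  by apply: root_dvdp; apply: mxminpoly_min.
split=> // p; rewrite AE horner_mx_uconjC // horner_mx_diag mxtrace_mulC mulmxA.
rewrite mulmxV // mul1mx mxtrace_diag big_map big_enum.
by apply: eq_bigr => i _; rewrite mxE.
Qed.

Lemma sum_count_mem (R : eqType) (V : nmodType) (rs s : seq R) (f : R -> V) :
  uniq rs -> {subset s <= rs} ->
  \sum_(r <- s) f r = \sum_(r <- rs) f r *+ count_mem r s.
Proof.
move=> rs_uniq; elim: s => [|x s IHs] s_rs.
  by rewrite big_nil big1_seq.
rewrite big_cons {}IHs => [|y ys]; last by apply: s_rs; rewrite inE ys orbT.
have -> : f x = \sum_(r <- rs | r == x) f r.
  rewrite -big_filter filter_pred1_uniq ?big_seq1 //.
  by apply: s_rs; rewrite mem_head.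
rewrite big_mkcond -big_split; apply: eq_bigr => r _ /=.
by rewrite mulrnDr eq_sym; case: eqP.
Qed.

(** The characteristic polynomial already splits over [R], so no further eigenvalue appears over
    [R[i]]. A member of [rs] missing from [s] is listed with multiplicity 0. *)
Lemma has_spectrum_roots (R : rcfType) (n : nat) (T : 'M[R]_n)
    (rs s : seq R) :
  uniq rs -> {subset s <= rs} -> char_poly T = \prod_(r <- s) ('X - r%:P) ->
  has_spectrum T [seq (r%:C, count_mem r s) | r <- rs].
Proof.
move=> rs_uniq s_rs charT.
have charTC : char_poly (map_mx (real_complex R) T) =
    \prod_(z <- map (real_complex R) s) ('X - z%:P).
  rewrite -map_char_poly charT rmorph_prod big_map /=.
  by apply: eq_bigr => r _; rewrite rmorphB /= map_polyX map_polyC.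
have unz : unzip1 [seq (r%:C, count_mem r s) | r <- rs] =
    map (real_complex R) rs by rewrite /unzip1 -map_comp.
have inj := fmorph_inj (real_complex R).
split.
- by rewrite unz map_inj_uniq.
- move=> a; rewrite unz eigenvalue_root_char charTC root_prod_XsubC.
  by move=> /mapP[r rs_r ->]; apply/map_f/s_rs.
- move=> a m /mapP[r rs_r [-> ->]]; rewrite charTC mu_prod_XsubC count_map.
  by apply: eq_count => x /=; rewrite (inj_eq inj).
Qed.

(** The minimal polynomial divides a squarefree product, so it is the product over a sublist of
    [rs]; having the same roots as the characteristic polynomial determines the sublist. *)
Lemma mxminpoly_roots (R : fieldType) (n : nat) (A : 'M[R]_n.+1)
    (rs s : seq R) :
  uniq rs -> horner_mx A (\prod_(r <- rs) ('X - r%:P)) = 0 ->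
  {subset s <= rs} -> char_poly A = \prod_(r <- s) ('X - r%:P) ->
  mxminpoly A = \prod_(r <- rs | r \in s) ('X - r%:P).
Proof.
move=> rs_uniq rsA0 s_rs charA.
have [m minA] := dvdp_prod_XsubC (mxminpoly_min rsA0).
have {}minA : mxminpoly A = \prod_(r <- mask m rs) ('X - r%:P).
  by apply/eqP; rewrite -eqp_monic ?mxminpoly_monic ?monic_prod_XsubC.
rewrite minA -[RHS]big_filter; apply/perm_big/uniq_perm.
- exact: mask_uniq.
- exact: filter_uniq.
move=> r; rewrite mem_filter -root_prod_XsubC -minA root_mxminpoly charA.
by rewrite root_prod_XsubC; apply/idP/andP => [rs_r|[] //]; split=> //; exact: s_rs.
Qed.

Lemma prod_XsubC_opp (R : comNzRingType) (r x : R) :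
  r ^+ 2 = x -> ('X - r%:P) * ('X - (- r)%:P) = 'X^2 - x%:P.
Proof. by move=> <-; rewrite rmorphXn rmorphN /=; ring. Qed.

Lemma prod_XsubC_quadratic (R : comNzRingType) (x y s p : R) :
  x + y = s -> x * y = p ->
  ('X - x%:P) * ('X - y%:P) = 'X^2 - s%:P * 'X + p%:P.
Proof. by move=> <- <-; rewrite rmorphM rmorphD /=; ring. Qed.

(* If p <> q, then rho^2 (p - q)^2 > 1 >= b^2. *)
Lemma balanced_multiplicities (R : rcfType) (n k lam b p q : nat) (rho : R) :
  (0 < lam)%N -> k = (1 + lam * n.+2)%N -> (b <= 1)%N ->
  rho ^+ 2 = k%:R - lam%:R ->
  rho *+ p - rho *+ q = - b%:R -> (p + q = n)%N -> p = n./2 /\ q = n./2.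
Proof.
move=> lam_gt0 kE b_le1 rho2 pq pqn.
suff pqE : p = q by split; lia.
have c_gt1 : 1 < rho ^+ 2.
  have : 1 <= lam%:R :> R by rewrite ler1n.
  rewrite rho2 kE natrD natrM -addn2 natrD => lam1.
  by have := ler0n R n; nra.
have bR : b%:R ^+ 2 <= 1 :> R by rewrite -natrX lern1; case: b b_le1 {pq} => [|[]].
have {bR} : (rho ^+ 2) * (p%:R - q%:R) ^+ 2 <= 1 :> R.
  suff -> : (rho ^+ 2) * (p%:R - q%:R) ^+ 2 = b%:R ^+ 2 :> R by [].
  by rewrite -[RHS]sqrrN -pq -[rho *+ p]mulr_natr -[rho *+ q]mulr_natr; ring.
have [//|neq_pq] := eqVneq p q.
have : 1 <= (p%:R - q%:R) ^+ 2 :> R.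
  move: neq_pq; rewrite neq_ltn.
  by case/orP; rewrite -(ler_nat R) -addn1 natrD; nra.
move=> sq_ge1 le1; have := lt_le_trans c_gt1 (ler_peMr (ltW (lt_trans ltr01 c_gt1)) sq_ge1).
by rewrite ltNge le1.
Qed.

(** * Spectra, minimal polynomials and eigenvectors of [M] and [S] from the matrix identities *)

Section SpectralPart.

Variables (R : rcfType) (n k lam : nat) (M : 'M[R]_n.+2).
Local Notation kR := (k%:R : R).
Local Notation lR := (lam%:R : R).
Local Notation c := (kR - lR).
Local Notation rho := (Num.sqrt (kR - lR)).
Local Notation delta := (Num.sqrt (kR ^+ 2 - 4 * lR)).
Local Notation alpha := ((kR + delta) / 2).
Local Notation beta := ((kR - delta) / 2).
Local Notation u := (const_mx 1 : 'cV[R]_n.+2).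
Local Notation e := (delta_mx 0 0 : 'cV[R]_n.+2).
Let S : 'M[R]_n.+1 := row' ord0 (col' ord0 M).

Hypothesis lam_gt0 : (0 < lam)%N.
Hypothesis kE : k = (1 + lam * n.+2)%N.
Hypothesis M_row0 : forall j, M 0 j = lR.
Hypothesis M_col0 : forall i, M i 0 = lR.
Hypothesis M_ones : M *m u = kR *: u - e.
Hypothesis M_sqr :
  M *m M = c%:M + (lR * kR) *: (u *m u^T) - kR *: (e *m e^T).

Lemma S_row_sum i : \sum_j S i j = c.
Proof.
have /matrixP/(_ (lift ord0 i) 0) := M_ones.
rewrite !mxE big_ord_recl !mxE M_col0 /= !mulr1 subr0 => <-.
rewrite [lR + _]addrC addrK.
by apply: eq_bigr => j _; rewrite !mxE mulr1.
Qed.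

Lemma S_ones p : S *m const_mx 1 = c *: const_mx 1 :> 'M_(n.+1, p).
Proof.
apply/matrixP=> i j; rewrite !mxE mulr1 -(S_row_sum i).
by apply: eq_bigr => l _; rewrite [const_mx _ _ _]mxE mulr1.
Qed.

(** The lower right block of [M *m M] is [S *m S] plus the constant [lR * lR] contributed by column
    and row 0, and [lR * kR - lR * lR = lR * c]. *)
Lemma S_sqr : S *m S = c%:M + (lR * c) *: const_mx 1.
Proof.
apply/matrixP=> i j.
have /matrixP/(_ (lift ord0 i) (lift ord0 j)) := M_sqr.
rewrite mxE big_ord_recl M_col0 M_row0 !mxE !big_ord1 !mxE /=.
rewrite (inj_eq lift_inj) !mulr0 subr0 !mulr1 => MM.
transitivity (\sum_(l < n.+1) M (lift ord0 i) (lift ord0 l) * M (lift ord0 l) (lift ord0 j)).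
  by apply: eq_bigr => l _; rewrite !mxE.
by apply: (addrI (lR * lR)); rewrite MM; ring.
Qed.

Lemma S_trace : \tr S = \tr M - lR.
Proof.
rewrite /mxtrace [in RHS]big_ord_recl M_row0 [lR + _]addrC addrK.
by apply: eq_bigr => i _; rewrite !mxE.
Qed.

Lemma kRE : kR = 1 + lR * (n%:R + 2).
Proof. by rewrite kE natrD natrM -addn2 natrD. Qed.

Lemma lR_ge1 : 1 <= lR. Proof. by rewrite ler1n. Qed.

Lemma c_gt1 : 1 < c.
Proof. by have := lR_ge1; have := ler0n R n; rewrite kRE; nra. Qed.

Lemma rho_sqr : rho ^+ 2 = c.
Proof. by rewrite sqr_sqrtr //; have := c_gt1; lra. Qed.

Lemma rho_gt0 : 0 < rho.
Proof. by rewrite sqrtr_gt0; have := c_gt1; lra. Qed.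

Lemma delta_gt0 : 0 < delta.
Proof.
by rewrite sqrtr_gt0; have := lR_ge1; have := ler0n R n; rewrite kRE; nra.
Qed.

Lemma delta_sqr : delta ^+ 2 = kR ^+ 2 - 4 * lR.
Proof. by rewrite sqr_sqrtr // ltW // -sqrtr_gt0 delta_gt0. Qed.

(** Keeps [alpha] and [beta] apart from [rho] and [- rho]. If also [a ^+ 2 = c], then [kR * a = kR],
    so [a = 1]; but 1 is a root of the quadratic only if [c = 1]. *)
Lemma M_quadratic_root a : a ^+ 2 = kR * a - lR -> a != 1 /\ a ^+ 2 != c.
Proof.
have k1 := c_gt1; move=> aE.
have a1 : a != 1 by apply/eqP => a1; move: aE; rewrite a1; lra.
split=> //; apply: contra_neq a1 => ac.
have : kR * (a - 1) = 0 by move: ac; rewrite aE; lra.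
by move/eqP; rewrite mulf_eq0 pnatr_eq0 kE /= subr_eq0 => /eqP.
Qed.

Lemma alpha_root : alpha ^+ 2 = kR * alpha - lR.
Proof.
have -> : alpha ^+ 2 = (kR ^+ 2 + delta ^+ 2 + 2 * kR * delta) / 4 by field.
by rewrite delta_sqr; field.
Qed.

Lemma beta_root : beta ^+ 2 = kR * beta - lR.
Proof.
have -> : beta ^+ 2 = (kR ^+ 2 + delta ^+ 2 - 2 * kR * delta) / 4 by field.
by rewrite delta_sqr; field.
Qed.

Lemma M_roots_uniq : uniq [:: alpha; beta; rho; - rho].
Proof.
have [_ ac] := M_quadratic_root alpha_root.
have [_ bc] := M_quadratic_root beta_root.
have d0 := delta_gt0; have r0 := rho_gt0; have r2 := rho_sqr.
rewrite /= !inE !negb_or !andbT; apply/and3P; split.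
- apply/and3P; split; first by apply/eqP; lra.
  + by apply: contra_neq ac => ->.
  + by apply: contra_neq ac => ->; rewrite sqrrN.
- apply/andP; split; first by apply: contra_neq bc => ->.
  by apply: contra_neq bc => ->; rewrite sqrrN.
- by apply/eqP; lra.
Qed.

Lemma S_roots_uniq : uniq [:: c; rho; - rho].
Proof.
have r0 := rho_gt0; have r2 := rho_sqr; have c1 := c_gt1.
rewrite /= !inE !negb_or !andbT; apply/andP; split; last by apply/eqP; lra.
(* Both [rho] and [- rho] have square [c], so this inequality separates [c] from them. *)
have cc : c ^+ 2 != c by apply/eqP; nra.
apply/andP; split; first by apply: contra_neq cc => {1}->.
by apply: contra_neq cc => {1}->; rewrite sqrrN.
Qed.

Lemma M_e : M *m e = lR *: u.
Proof.
apply/matrixP=> i j; rewrite !mxE (bigD1 0) //= big1 ?addr0 ?mxE.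
  by rewrite M_col0 (ord1 j) eqxx.
by move=> l /negPf l0; rewrite mxE l0 mulr0.
Qed.

(** The columns of [M *m M - c%:M] lie in the span of [u] and [e]. This plane is stable under [M],
    which acts on it with trace [kR] and determinant [lR], so the quadratic factor kills it. *)
Lemma M_annihil :
  (M *m M - kR *: M + lR%:M) *m (M *m M - c%:M) = 0.
Proof.
pose Q := M *m M - kR *: M + lR%:M.
have Qu : Q *m u = 0.
  rewrite /Q mulmxDl mulmxBl -mulmxA M_ones mulmxBr -scalemxAr -scalemxAl.
  rewrite M_ones M_e mul_scalar_mx.
  by apply/matrixP=> i j; rewrite !mxE; ring.
have Qe : Q *m e = 0.
  rewrite /Q mulmxDl mulmxBl -mulmxA M_e -scalemxAr -scalemxAl.
  rewrite M_ones M_e mul_scalar_mx.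
  by apply/matrixP=> i j; rewrite !mxE; ring.
rewrite -/Q M_sqr addrAC [_ - c%:M]addrAC subrr add0r mulmxBr -!scalemxAr !mulmxA.
by rewrite Qu Qe !mul0mx !scaler0 subrr.
Qed.

(** [S *m S - c%:M] is a multiple of the all-ones matrix, whose columns are eigenvectors of [S] for
    [c]. *)
Lemma S_annihil : (S - c%:M) *m (S *m S - c%:M) = 0.
Proof.
rewrite S_sqr [c%:M + _]addrC addrK -scalemxAr mulmxBl S_ones mul_scalar_mx.
by rewrite subrr scaler0.
Qed.

Let rsM := [:: alpha; beta; rho; - rho].
Let rsS := [:: c; rho; - rho].

Lemma M_quadratic_prod :
  ('X - alpha%:P) * ('X - beta%:P) = 'X^2 - kR%:P * 'X + lR%:P.
Proof.
apply: prod_XsubC_quadratic; first by field.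
have -> : alpha * beta = (kR ^+ 2 - delta ^+ 2) / 4 by field.
by rewrite delta_sqr; field.
Qed.

Lemma M_prod :
  \prod_(r <- rsM) ('X - r%:P) =
  ('X^2 - kR%:P * 'X + lR%:P) * ('X^2 - (kR - lR)%:P).
Proof.
rewrite !big_cons big_nil mulr1 (prod_XsubC_opp rho_sqr) mulrA.
by rewrite M_quadratic_prod.
Qed.

Lemma S_prod :
  \prod_(r <- rsS) ('X - r%:P) = ('X - (kR - lR)%:P) * ('X^2 - (kR - lR)%:P).
Proof. by rewrite !big_cons big_nil mulr1 (prod_XsubC_opp rho_sqr). Qed.

Lemma S_annihil_horner : horner_mx S (\prod_(r <- rsS) ('X - r%:P)) = 0.
Proof.
rewrite S_prod rmorphM /= ![horner_mx S (_ - _)]rmorphB /= rmorphXn /=.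
by rewrite !horner_mx_C !horner_mx_X; exact: S_annihil.
Qed.

Lemma M_annihil_horner : horner_mx M (\prod_(r <- rsM) ('X - r%:P)) = 0.
Proof.
rewrite M_prod rmorphM /= [horner_mx M (_ + _)]rmorphD.
rewrite /= ![horner_mx M (_ - _)]rmorphB /= [horner_mx M (_%:P * _)]rmorphM /= rmorphXn /=.
rewrite !horner_mx_C !horner_mx_X -[RHS]M_annihil -!mulmxE !expr2.
by rewrite mul_scalar_mx.
Qed.

Lemma S_spectrum (b : nat) : (b <= 1)%N -> \tr M = kR - b%:R ->
  [/\ has_spectrum S [:: (c%:C, 1%N); (rho%:C, n./2); ((- rho)%:C, n./2)],
      (0 < n)%N ->
        mxminpoly S = ('X - (kR - lR)%:P) * ('X^2 - (kR - lR)%:P) &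
      n = 0%N -> mxminpoly S = 'X - (kR - lR)%:P].
Proof.
move=> b_le1 trM.
have [s s_rs [charS trS]] := diagonalizable_roots S_roots_uniq S_annihil_horner.
have {}trS p : \tr (horner_mx S p) = p.[c] *+ count_mem c s +
    (p.[rho] *+ count_mem rho s + p.[- rho] *+ count_mem (- rho) s).
  rewrite trS (sum_count_mem (fun r => p.[r]) S_roots_uniq s_rs).
  by rewrite !big_cons big_nil addr0.
have c1 := c_gt1; have r2 := rho_sqr.
have mc : count_mem c s = 1%N.
  have := trS ('X^2 - c%:P).
  rewrite rmorphB /= rmorphXn /= horner_mx_C horner_mx_X expr2 -mulmxE S_sqr.
  rewrite [c%:M + _]addrC addrK mxtraceZ !hornerE sqrrN r2 subrr !mul0rn /= !addr0.
  have -> : \tr (const_mx 1 : 'M[R]_n.+1) = n.+1%:R.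
    rewrite /mxtrace (eq_bigr (fun=> 1)) ?sumr_const ?card_ord //.
    by move=> i _; rewrite mxE.
  (* Since [c = 1 + lR * n.+1%:R], the trace equals the value of ['X^2 - c%:P] at [c]; hence [c] is
     a simple root. *)
  have lE : lR * c * n.+1%:R = c ^+ 2 - c.
    by rewrite -addn1 natrD kRE; ring.
  have c2 : c ^+ 2 - c != 0 by apply/eqP; nra.
  rewrite lE -[X in _ = X]mulr_natr -{1}[_ - c]mulr1.
  move=> /(mulfI c2)/esym/eqP.
  by rewrite pnatr_eq1 => /eqP.
have mtot : (count_mem rho s + count_mem (- rho) s = n)%N.
  have := trS 1; rewrite rmorph1 mxtrace1 !hornerE mc /= -!mulrnDr => /eqP.
  by rewrite eqr_nat => /eqP; lia.
have [mp mq] : count_mem rho s = n./2 /\ count_mem (- rho) s = n./2.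
  apply: (balanced_multiplicities lam_gt0 kE b_le1 r2) => //.
  (* The trace of [S] is [c - b%:R] and [c] is simple, so [rho] and [- rho] together contribute
     [- b%:R]. *)
  have := trS 'X; rewrite horner_mx_X S_trace trM !hornerX mc mulr1n mulNrn.
  move: (rho *+ _) (rho *+ _) => x y; lra.
have mem_s x : x \in s = (0 < count_mem x s)%N by rewrite -has_count has_pred1.
split.
- have := has_spectrum_roots S_roots_uniq s_rs charS.
  by rewrite /= mc mp mq.
(* Both multiplicities are [n./2] and add up to [n], so [n] is even and a positive [n] is at least
   2. *)
- move=> n_gt0; have m_gt0 : (0 < n./2)%N by lia.
  rewrite (mxminpoly_roots S_roots_uniq S_annihil_horner s_rs charS) -S_prod.
  by rewrite !big_cons !big_nil !mem_s mc mp mq m_gt0.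
- move=> n0; rewrite (mxminpoly_roots S_roots_uniq S_annihil_horner s_rs charS).
  by rewrite !big_cons !big_nil !mem_s mc mp mq n0 /= mulr1.
Qed.

(* For a = beta this is the trace of q(M), q the cofactor of the root alpha. *)
Lemma M_trace_cofactor a :
  \tr ((M - a%:M) *m (M *m M - c%:M)) =
  kR * (kR * (kR - 1) - 2 * lR - a * (kR - 2)).
Proof.
have tr_uv (v w : 'cV[R]_n.+2) : \tr (v *m w^T) = \sum_i v i 0 * w i 0.
  by apply: eq_bigr => i _; rewrite mxE big_ord1 mxE.
have tr_ve (v : 'cV[R]_n.+2) : \tr (v *m e^T) = v 0 0.
  rewrite tr_uv (bigD1 0) //= big1 ?addr0 ?mxE ?mulr1 // => i /negPf i0.
  by rewrite mxE i0 mulr0.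
have tr_vu (v : 'cV[R]_n.+2) : \tr (v *m u^T) = \sum_i v i 0.
  by rewrite tr_uv; apply: eq_bigr => i _; rewrite mxE mulr1.
have sum_u x : \sum_i (x *: u) i 0 = x * n.+2%:R.
  rewrite (eq_bigr (fun=> x)) => [|i _]; last by rewrite !mxE mulr1.
  by rewrite sumr_const card_ord mulr_natr.
have sum_e : \sum_i e i 0 = 1.
  by rewrite -tr_vu -mxtrace_tr trmx_mul trmxK tr_ve mxE.
(* The second factor is a combination of [u *m u^T] and [e *m e^T], so only the entry sum of
   [(M - a%:M) *m u] and entry 0 of [(M - a%:M) *m e] are needed. *)
rewrite M_sqr addrAC [_ - c%:M]addrAC subrr add0r mulmxBr -!scalemxAr !mulmxA.
rewrite raddfB /= !mxtraceZ tr_ve tr_vu.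
have -> : (M - a%:M) *m u = kR *: u - e - a *: u.
  by rewrite mulmxBl M_ones mul_scalar_mx.
have -> : (M - a%:M) *m e = lR *: u - a *: e.
  by rewrite mulmxBl M_e mul_scalar_mx.
have -> : \sum_i (kR *: u - e - a *: u) i 0 = (kR - a) * n.+2%:R - 1.
  rewrite -sum_u -sum_e -sumrB; apply: eq_bigr => i _; rewrite !mxE; ring.
by rewrite !mxE !eqxx -(addn2 n) natrD kRE /=; ring.
Qed.

Lemma M_spectrum (b : nat) : (b <= 1)%N -> \tr M = kR - b%:R ->
  [/\ has_spectrum M [:: (alpha%:C, 1%N); (beta%:C, 1%N);
                          (rho%:C, n./2); ((- rho)%:C, n./2)],
      (0 < n)%N -> mxminpoly M =
        ('X^2 - kR%:P * 'X + lR%:P) * ('X^2 - (kR - lR)%:P) &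
      n = 0%N -> mxminpoly M = 'X^2 - kR%:P * 'X + lR%:P].
Proof.
move=> b_le1 trM.
have [s s_rs [charM trHM]] := diagonalizable_roots M_roots_uniq M_annihil_horner.
have {}trHM p : \tr (horner_mx M p) =
    p.[alpha] *+ count_mem alpha s + (p.[beta] *+ count_mem beta s +
    (p.[rho] *+ count_mem rho s + p.[- rho] *+ count_mem (- rho) s)).
  rewrite trHM (sum_count_mem (fun r => p.[r]) M_roots_uniq s_rs).
  by rewrite !big_cons big_nil addr0.
have r2 := rho_sqr; have ar := alpha_root; have br := beta_root.
have d0 := delta_gt0.
(* The factor ['X^2 - c%:P] removes [rho] and [- rho] from the trace; choosing [a] as [beta] or
   [alpha] removes one more root. *)
have tr_ab a : ((alpha - a) * (alpha ^+ 2 - c)) *+ count_mem alpha s +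
    ((beta - a) * (beta ^+ 2 - c)) *+ count_mem beta s =
    kR * (kR * (kR - 1) - 2 * lR - a * (kR - 2)).
  rewrite -M_trace_cofactor.
  have := trHM (('X - a%:P) * ('X^2 - c%:P)).
  rewrite rmorphM /= ![horner_mx M (_ - _)]rmorphB /= rmorphXn /=.
  rewrite !horner_mx_C horner_mx_X expr2 mulmxE => ->.
  rewrite !hornerM !hornerD !hornerN !hornerXn !hornerX !hornerC.
  by rewrite sqrrN r2 subrr !mulr0 !mul0rn !addr0.
(* Here [x] and [y] are the two roots of the quadratic. The trace equals the nonzero value of the
   cofactor at [x], which forces multiplicity 1. *)
have mult x y : x ^+ 2 = kR * x - lR -> x + y = kR -> x != y ->
    kR * (kR * (kR - 1) - 2 * lR - y * (kR - 2)) = (x - y) * (x ^+ 2 - c) /\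
    (x - y) * (x ^+ 2 - c) != 0.
  move=> xr xy neq_xy; have [_ xc] := M_quadratic_root xr; split.
    have -> : y = kR - x by rewrite -xy; ring.
    have -> : (x - (kR - x)) * (x ^+ 2 - c) =
      2 * (x * x ^+ 2) - kR * x ^+ 2 - 2 * c * x + kR * c by ring.
    have -> : x * x ^+ 2 = kR * x ^+ 2 - lR * x by rewrite [in LHS]xr; ring.
    by rewrite xr; ring.
  by rewrite mulf_neq0 ?subr_eq0.
have ma : count_mem alpha s = 1%N.
  have [| |E nz] := mult alpha beta ar; [by field | by apply/eqP; lra |].
  have := tr_ab beta; rewrite subrr mul0r mul0rn addr0 E => /eqP.
  rewrite -[_ *+ _]mulr_natr -[X in _ == X]mulr1 (inj_eq (mulfI nz)).
  by rewrite pnatr_eq1 => /eqP.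
have mb : count_mem beta s = 1%N.
  have [| |E nz] := mult beta alpha br; [by field | by apply/eqP; lra |].
  have := tr_ab alpha; rewrite subrr mul0r mul0rn add0r E => /eqP.
  rewrite -[_ *+ _]mulr_natr -[X in _ == X]mulr1 (inj_eq (mulfI nz)).
  by rewrite pnatr_eq1 => /eqP.
have mtot : (count_mem rho s + count_mem (- rho) s = n)%N.
  have := trHM 1; rewrite rmorph1 mxtrace1 !hornerC ma mb -!mulrnDr => /eqP.
  by rewrite eqr_nat => /eqP; lia.
have [mp mq] : count_mem rho s = n./2 /\ count_mem (- rho) s = n./2.
  apply: (balanced_multiplicities lam_gt0 kE b_le1 r2) => //.
  have := trHM 'X; rewrite horner_mx_X trM !hornerX ma mb !mulr1n mulNrn.
  move: (rho *+ _) (rho *+ _) => x y; lra.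
have mem_s x : x \in s = (0 < count_mem x s)%N by rewrite -has_count has_pred1.
split.
- have := has_spectrum_roots M_roots_uniq s_rs charM.
  by rewrite /= ma mb mp mq.
- move=> n_gt0; have m_gt0 : (0 < n./2)%N by lia.
  rewrite (mxminpoly_roots M_roots_uniq M_annihil_horner s_rs charM) -M_prod.
  by rewrite !big_cons !big_nil !mem_s ma mb mp mq m_gt0.
- move=> n0; rewrite (mxminpoly_roots M_roots_uniq M_annihil_horner s_rs charM).
  rewrite !big_cons !big_nil !mem_s ma mb mp mq n0 /= mulr1.
  exact: M_quadratic_prod.
Qed.

(** Applying [S] twice gives [c *: w], while by [S_sqr] it gives [c *: w] plus a vector whose
    entries are all [lR * c] times the sum of [w]. *)
Lemma S_eigenvector_sum a w : a ^+ 2 = c -> is_eigenvector S a w ->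
  \sum_i w i 0 = 0.
Proof.
move=> ac [_ Sw].
have : S *m S *m w = c *: w by rewrite -mulmxA Sw -scalemxAr Sw scalerA -expr2 ac.
rewrite S_sqr mulmxDl mul_scalar_mx => /(canRL (addKr _)).
rewrite addNr => /matrixP/(_ 0 0); rewrite -scalemxAl !mxE.
move/eqP; rewrite mulf_eq0 => /orP[|/eqP w0].
  by have := c_gt1; have := lR_ge1 => ? ? /eqP; nra.
by rewrite -[RHS]w0; apply: eq_bigr => i _; rewrite mxE mul1r.
Qed.

Lemma M_block : M = block_mx lR%:M (const_mx lR) (const_mx lR) S :> 'M_(1 + n.+1).
Proof.
rewrite -[LHS](@submxK _ 1 n.+1 1 n.+1); congr block_mx; apply/matrixP => i j.
- by rewrite !mxE !ord1 eqxx -(M_row0 0); congr (M _ _); apply: val_inj.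
- by rewrite !mxE -(M_row0 (rshift 1 j)); congr (M _ _); apply: val_inj; rewrite /= ord1.
- by rewrite !mxE -(M_col0 (rshift 1 i)); congr (M _ _); apply: val_inj; rewrite /= ord1.
- by rewrite !mxE; congr (M _ _); apply: val_inj.
Qed.

Lemma M_mul_col0 (w : 'cV_n.+1) : \sum_i w i 0 = 0 ->
  (M : 'M_(1 + n.+1)) *m col_mx 0 w = col_mx 0 (S *m w).
Proof.
move=> w0; rewrite M_block mul_block_col !mulmx0 !add0r; congr col_mx.
apply/matrixP => i j; rewrite !mxE (ord1 j) -[RHS](mulr0 lR) -[in RHS]w0 mulr_sumr.
by apply: eq_bigr => l _; rewrite mxE.
Qed.

(** Since [M *m M *m v = c *: v], the rank-one terms of [M_sqr] cancel on [v]: a multiple of [u] by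
    the sum of [v] equals a multiple of [e] by [v 0 0]. As [u] and [e] are independent, both scalars
    vanish, and on such vectors [M] acts as [S]. *)
Lemma M_eigenvectorE a (v : 'cV[R]_(1 + n.+1)) : a ^+ 2 = c ->
  is_eigenvector M a v <->
  exists w : 'cV[R]_n.+1,
    [/\ v = col_mx 0 w, \sum_i w i 0 = 0 & is_eigenvector S a w].
Proof.
move=> ac; split=> [[v0 Mv]|[w [-> w0 [wn0 Sw]]]]; last first.
  split; last first.
    rewrite M_mul_col0 // Sw; apply: etrans (esym (scale_col_mx a (0 : 'M_1) w)).
    by rewrite scaler0.
  apply: contra_neq wn0 => /(congr1 (@dsubmx R 1 n.+1 1)).
  by rewrite col_mxKd linear0.
have : M *m M *m v = c *: v.
  by rewrite -mulmxA Mv -scalemxAr Mv scalerA -expr2 ac.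
rewrite M_sqr mulmxBl mulmxDl mul_scalar_mx -addrA => /(canRL (addKr _)).
rewrite addNr => /eqP; rewrite subr_eq0 -!scalemxAl -!mulmxA => /eqP E.
have uv : u^T *m v = (\sum_i v i 0)%:M.
  apply/matrixP => i j; rewrite !mxE !ord1 eqxx mulr1n.
  by apply: eq_bigr => l _; rewrite !mxE mul1r.
have ev : e^T *m v = (v 0 0)%:M.
  apply/matrixP => i j; rewrite !mxE !ord1 eqxx mulr1n (bigD1 0) //= big1.
    by rewrite !mxE mul1r addr0.
  by move=> l /negPf l0; rewrite !mxE l0 mul0r.
rewrite uv ev !mul_mx_scalar in E.
have sum_v : \sum_i v i 0 = 0.
  (* At index 1 the vector [e] vanishes, so only the sum of [v] remains. *)
  move/matrixP/(_ (rshift 1 0) 0): (E); rewrite !mxE /= mulr1 !mulr0.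
  by move/eqP; rewrite !mulf_eq0 !pnatr_eq0 kE eqn0Ngt lam_gt0 => /eqP.
have v00 : v 0 0 = 0.
  move/matrixP/(_ 0 0): (E); rewrite sum_v !mxE /= !mulr1 !mulr0 => /esym.
  by move/eqP; rewrite mulf_eq0 pnatr_eq0 kE => /eqP.
have vE : v = col_mx 0 (dsubmx v).
  rewrite -[LHS]vsubmxK; congr col_mx; apply/matrixP=> i j.
  by rewrite !mxE !ord1 -[RHS]v00; congr (v _ _); apply: val_inj.
have sum_w : \sum_i dsubmx v i 0 = 0.
  rewrite -[RHS]sum_v [RHS]big_split_ord big_ord1 /=.
  rewrite [lshift _ _](_ : _ = 0) ?v00 ?add0r; last exact: val_inj.
  by apply: eq_bigr => i _; rewrite mxE.
exists (dsubmx v); split=> //; split.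
  by apply: contra_neq v0 => w0; rewrite vE w0 col_mx0.
have : col_mx 0 (S *m dsubmx v) = col_mx (a *: (0 : 'M_1)) (a *: dsubmx v).
  by rewrite -scale_col_mx -M_mul_col0 // -vE.
by case/eq_col_mx.
Qed.

End SpectralPart.

(** * Sums over the cosets of a multiplicative subgroup that is a difference set *)

Section CyclotomicSums.

Variables (R : rcfType) (F : finFieldType) (n k lam : nat) (K : {set F}).
Variables (r : 'I_n.+2 -> F) (M : 'M[R]_n.+2).
Local Notation kR := (k%:R : R).
Local Notation lR := (lam%:R : R).

Hypothesis K0 : 0 \notin K.
Hypothesis K1 : 1 \in K.
Hypothesis KM : forall x y, x \in K -> (x * y \in K) = (y \in K).
Hypothesis r0 : r 0 = 1.
Hypothesis r_neq0 : forall i, r i != 0.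
Hypothesis rP : forall x, x != 0 -> exists i, forall j, (x / r j \in K) = (j == i).
Hypothesis KD : difference_set K k lam.

(* The indicator of the coset r_i K; it vanishes at 0 because K does. *)
Let chi i x : R := (x / r i \in K)%:R.
Hypothesis ME : forall i j, M i j = \sum_a chi i a * chi j (1 - a).

Lemma K_neq0 x : x \in K -> x != 0.
Proof. by apply: contraTneq => ->. Qed.

Lemma chi0 i : chi i 0 = 0.
Proof. by rewrite /chi mul0r (negPf K0). Qed.

Lemma chi_ord0 x : chi 0 x = (x \in K)%:R.
Proof. by rewrite /chi r0 divr1. Qed.

Lemma chi1 i : chi i 1 = (i == 0)%:R.
Proof.
have [j jP] := rP (oner_neq0 F).
by rewrite /chi jP; congr (_%:R); congr (_ == _); apply/esym/eqP;
  rewrite -jP r0 divr1.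
Qed.

Lemma chiM i t x : t \in K -> chi i (t * x) = chi i x.
Proof. by move=> tK; rewrite /chi -mulrA KM. Qed.

(** The cosets of [K] partition the nonzero elements. *)
Lemma sum_chi_class x : \sum_i chi i x = (x != 0)%:R.
Proof.
have [->|/rP [i iP]] := eqVneq x 0.
  by apply: big1 => i _; rewrite chi0.
rewrite (bigD1 i) //= /chi iP eqxx big1 ?addr0 // => j ji.
by rewrite iP (negPf ji).
Qed.

Lemma sum_in_K (f : F -> R) : \sum_(t in K) f t = \sum_t (t \in K)%:R * f t.
Proof.
by rewrite big_mkcond; apply: eq_bigr => t _; case: ifP => _; rewrite ?mul1r ?mul0r.
Qed.

Lemma sum_K1 : \sum_(t in K) 1 = kR.
Proof. by case: KD => <- _ _; rewrite sumr_const. Qed.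

Lemma scale_bij (t : F) : t != 0 -> bijective ( *%R t).
Proof. by move=> t0; apply: (Bijective (mulKf t0) (mulVKf t0)). Qed.

Lemma sum_chi i : \sum_x chi i x = kR.
Proof.
rewrite (reindex _ (onW_bij _ (scale_bij (r_neq0 i)))) /=.
rewrite -sum_K1 sum_in_K; apply: eq_bigr => t _.
by rewrite /chi [r i * t]mulrC mulfK // mulr1.
Qed.

Lemma sum_chi_mul i j : \sum_x chi i x * chi j x = kR *+ (i == j).
Proof.
have [<-|ij] := eqVneq i j.
  rewrite -(sum_chi i); apply: eq_bigr => x _; rewrite /chi.
  by case: (_ \in K); rewrite ?mulr1 ?mulr0.
rewrite mulr0n; apply: big1 => x _; have [->|/rP[l lP]] := eqVneq x 0.
  by rewrite chi0 mul0r.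
rewrite /chi !lP; have [il|] := eqVneq i l; last by rewrite mul0r.
by rewrite -il eq_sym (negPf ij) mulr0.
Qed.

(** Pairs are grouped by difference: the diagonal gives 0 exactly [k] times, and each nonzero [e]
    arises [lam] times. The counting condition of the difference set enters here. *)
Lemma sum_K_diff (G : F -> R) :
  \sum_(s in K) \sum_(t in K) G (s - t) = kR * G 0 + lR * \sum_(e | e != 0) G e.
Proof.
case: KD => cardK _ Kdiff.
rewrite pair_big /= (partition_big (fun p => p.1 - p.2) predT) //= (bigD1 0) //=.
have const e : \sum_(p : F * F | (p.1 \in K) && (p.2 \in K) && (p.1 - p.2 == e))
    G (p.1 - p.2) = #|[set p in setX K K | p.1 - p.2 == e]|%:R * G e.
  rewrite -sum1_card natr_sum mulr_suml; apply: eq_big => [p|p /andP[_ /eqP->]].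
    by rewrite !inE.
  by rewrite mul1r.
congr (_ + _); last first.
  rewrite mulr_sumr; apply: eq_bigr => e e0.
  by rewrite const Kdiff.
rewrite const -cardK; congr (_%:R * _).
rewrite -(card_imset K (f := fun x => (x, x))); last by move=> x y [].
apply: eq_card => -[x y]; rewrite !inE /= subr_eq0.
apply/andP/imsetP => [[/andP[xK yK] /eqP xy]|[z zK [-> ->]]]; last by rewrite zK.
by exists x; rewrite // -xy.
Qed.

(* The left-hand side is the double sum of G (s - t) after scaling by s. *)
Lemma sum_K_invariant (G : F -> R) :
  (forall t e, t \in K -> G (t * e) = G e) ->
  kR * \sum_(t in K) G (1 - t) = kR * G 0 + lR * \sum_(e | e != 0) G e.
Proof.
move=> GK; rewrite -sum_K_diff -sum_K1 mulr_suml; apply: eq_bigr => s sK.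
rewrite mul1r [RHS](reindex _ (onW_bij _ (scale_bij (K_neq0 sK)))) /=.
by apply: eq_big => t; [rewrite KM|rewrite -[X in X - _ * t]mulr1 -mulrBr GK].
Qed.

(** Both sides test whether [x] and [y] lie in the same coset. At [x = y = 0] no coset contributes,
    whereas every [t] in [K] solves [y = t * x]; hence the term in [kR]. *)
Lemma sum_chi_class_mul x y :
  \sum_i chi i x * chi i y + kR *+ ((x == 0) && (y == 0)) =
  \sum_(t in K) (y == t * x)%:R.
Proof.
have [->|x0] /= := eqVneq x 0.
  rewrite big1 ?add0r => [|i _]; last by rewrite chi0 mul0r.
  rewrite -sum_K1 -sumrMnl; apply: eq_bigr => t _.
  by rewrite mulr0; case: eqP.
rewrite addr0; have [i iP] := rP x0.
rewrite (bigD1 i) //= big1 ?addr0 => [|j ji]; last first.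
  by rewrite /chi iP (negPf ji) mul0r.
have xiK : x / r i \in K by rewrite iP.
rewrite {1}/chi xiK mul1r.
have -> : chi i y = (y / x \in K)%:R.
  rewrite /chi -(KM (y / x) xiK); congr (_ \in K)%:R.
  by field; rewrite x0 r_neq0.
rewrite sum_in_K (bigD1 (y / x)) //= divfK // eqxx mulr1 big1 ?addr0 // => t tyx.
case: eqP => [E|]; last by rewrite mulr0.
by move: tyx; rewrite E mulfK // eqxx.
Qed.

Lemma k_gt0 : (0 < k)%N.
Proof. by case: KD => <- _ _; apply/card_gt0P; exists 1. Qed.

Lemma kR_neq0 : kR != 0.
Proof. by rewrite pnatr_eq0 -lt0n k_gt0. Qed.

Lemma cyclotomic_sym i j : M i j = M j i.
Proof.
rewrite !ME (reindex_inj (inv_inj (subKr 1))) /=.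
by apply: eq_bigr => a _; rewrite subKr mulrC.
Qed.

(** [sum_K_invariant] applies to the indicator [chi j], which vanishes at 0 and has total [kR]. *)
Lemma cyclotomic_row0 j : M 0 j = lR.
Proof.
apply: (mulfI kR_neq0); rewrite ME.
have -> : \sum_a chi 0 a * chi j (1 - a) = \sum_(t in K) chi j (1 - t).
  by rewrite sum_in_K; apply: eq_bigr => a _; rewrite chi_ord0.
rewrite sum_K_invariant; last exact: chiM.
by rewrite chi0 mulr0 add0r mulrC -(sum_chi j) [in RHS](bigD1 0) //= chi0 add0r.
Qed.

(** Over all [j] the factors [chi j (1 - a)] add up to 1, except at [a = 1], where the lost term is
    [chi i 1]. *)
Lemma cyclotomic_row_sum i : \sum_j M i j = kR - (i == 0)%:R.
Proof.
under eq_bigr do rewrite ME.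
rewrite exchange_big /= -(sum_chi i) -chi1.
under eq_bigr => a _ do rewrite -mulr_sumr sum_chi_class subr_eq0.
rewrite (bigD1 1) //= eqxx mulr0 add0r [in RHS](bigD1 1) //=.
rewrite [chi i 1 + _]addrC addrK.
by apply: eq_bigr => a a1; rewrite eq_sym a1 mulr1.
Qed.

(** Row 0 of [M] has [n.+2] entries equal to [lam], and its sum is [k - 1]. *)
Lemma difference_set_card : k = (1 + lam * n.+2)%N.
Proof.
have := cyclotomic_row_sum 0; rewrite (eq_bigr (fun=> lR)) => [|j _]; last exact: cyclotomic_row0.
rewrite sumr_const card_ord eqxx => /esym/(canRL (subrK _))/eqP.
by rewrite -mulrnA -natrD addnC eqr_nat => /eqP.
Qed.

Lemma cyclotomic_sqr_entry i j :
  \sum_l M i l * M l j =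
  (kR - lR) *+ (i == j) + lR * kR - kR *+ ((i == 0) && (j == 0)).
Proof.
(* A pair a, d with 1 - d = t (1 - a) becomes, for u = t a, a solution of
   1 - t = d - u; only a = d = 1 fails to determine t. *)
pose G e := \sum_d \sum_u chi j d * chi i u * (d - u == e)%:R.
have GK t e : t \in K -> G (t * e) = G e.
  move=> tK; have tb := scale_bij (K_neq0 tK).
  rewrite /G (reindex _ (onW_bij _ tb)) /=; apply: eq_bigr => d _.
  rewrite (reindex _ (onW_bij _ tb)) /=; apply: eq_bigr => v _.
  by rewrite !chiM // -mulrBr (inj_eq (mulfI (K_neq0 tK))).
have G0 : G 0 = kR *+ (i == j).
  rewrite -sum_chi_mul; apply: eq_bigr => d _.
  rewrite (bigD1 d) //= subrr eqxx mulr1 mulrC big1 ?addr0 // => v vd.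
  by rewrite subr_eq0 eq_sym (negPf vd) mulr0.
have sumG : \sum_e G e = kR * kR.
  rewrite exchange_big /= -{1}(sum_chi j) mulr_suml; apply: eq_bigr => d _.
  rewrite exchange_big /= -(sum_chi i) mulr_sumr; apply: eq_bigr => v _.
  rewrite (bigD1 (d - v)) //= eqxx mulr1 big1 ?addr0 // => e ed.
  by rewrite eq_sym (negPf ed) mulr0.
(* [N] counts the solutions of [1 - t = d - u] with [t] in [K] and [d], [u] in the cosets of [r j]
   and [r i]. *)
pose N := \sum_(t in K) G (1 - t).
have NE : N = (kR - lR) *+ (i == j) + lR * kR.
  apply: (mulfI kR_neq0); rewrite sum_K_invariant // G0.
  have -> : \sum_(e | e != 0) G e = kR * kR - kR *+ (i == j).
    by rewrite -G0 -sumG [in RHS](bigD1 0) //= addrC addrK.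
  by case: (i == j); rewrite ?mulr1n ?mulr0n; ring.
rewrite -NE; apply: (canRL (addrK _)).
(* The correction becomes a double sum supported at [a = d = 1], so that [sum_chi_class_mul] applies
   term by term. *)
have -> : kR *+ ((i == 0) && (j == 0)) =
    \sum_a \sum_d chi i a * chi j d * (kR *+ ((1 - a == 0) && (1 - d == 0))).
  rewrite (bigD1 1) //= (bigD1 1) //= subrr eqxx !chi1 !big1 ?addr0.
  - by case: eqP; case: eqP; rewrite /= ?mul1r ?mul0r ?mulr0.
  - move=> a a1; apply: big1 => d _.
    by rewrite [1 - a == 0]subr_eq0 [1 == a]eq_sym (negPf a1) mulr0n mulr0.
  - by move=> d d1; rewrite [1 - d == 0]subr_eq0 [1 == d]eq_sym (negPf d1) andbF mulr0n mulr0.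
have -> : \sum_l M i l * M l j =
    \sum_a \sum_d chi i a * chi j d * \sum_l chi l (1 - a) * chi l (1 - d).
  transitivity (\sum_l \sum_a \sum_d
      chi i a * chi j d * (chi l (1 - a) * chi l (1 - d))).
    apply: eq_bigr => l _; rewrite (cyclotomic_sym l j) !ME mulr_suml.
    by apply: eq_bigr => a _; rewrite mulr_sumr; apply: eq_bigr => d _; ring.
  rewrite exchange_big /=; apply: eq_bigr => a _.
  rewrite exchange_big /=; apply: eq_bigr => d _.
  by rewrite mulr_sumr.
rewrite -big_split /=.
transitivity (\sum_a \sum_d \sum_(t in K)
    chi i a * chi j d * (1 - d == t * (1 - a))%:R).
  apply: eq_bigr => a _; rewrite -big_split /=; apply: eq_bigr => d _.
  by rewrite -mulrDr sum_chi_class_mul mulr_sumr.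
rewrite exchange_big /=; under eq_bigr do rewrite exchange_big /=.
rewrite exchange_big /=; apply: eq_bigr => t tK; apply: eq_bigr => d _.
rewrite [RHS](reindex _ (onW_bij _ (scale_bij (K_neq0 tK)))) /=.
apply: eq_bigr => a _; rewrite chiM // [chi i a * _]mulrC; congr (_ * (nat_of_bool _)%:R).
by rewrite -[LHS]subr_eq0 -[RHS]subr_eq0 -[RHS]oppr_eq0; congr (_ == 0); ring.
Qed.

(** The diagonal sum counts the pairs [a], [t] with [t] in [K] and [1 - a = t * a], that is
    [a = (1 + t)^-1]: one for each [t] other than [-1]. *)
Lemma cyclotomic_trace : \tr M = kR - (-1 \in K)%:R.
Proof.
transitivity (\sum_a \sum_(t in K) ((1 - a == t * a)%:R : R)).
  rewrite /mxtrace; under eq_bigr do rewrite ME.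
  rewrite exchange_big /=; apply: eq_bigr => a _; rewrite -sum_chi_class_mul.
  (* [a] and [1 - a] are never both 0, so the correction term of [sum_chi_class_mul] is absent. *)
  have [->|] := eqVneq a 0; rewrite /= ?addr0 // subr0 oner_eq0 addr0 //.
rewrite exchange_big /=.
transitivity (\sum_(t in K) ((t != -1)%:R : R)).
  apply: eq_bigr => t tK; have [->|t1] /= := eqVneq t (-1).
    apply: big1 => a _; rewrite mulN1r -subr_eq0 opprK subrK oner_eq0 //.
  have t10 : 1 + t != 0 by rewrite addrC addr_eq0.
  rewrite (bigD1 (1 + t)^-1) //= big1 ?addr0.
    by rewrite (_ : _ == _) //; apply/eqP; field.
  move=> a aE; case: eqP => // E; case/eqP: aE.
  by apply: (mulfI t10); rewrite mulfV // mulrDl mul1r -E addrC subrK.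
have [K1'|K1'] := boolP (-1 \in K).
  rewrite -sum_K1 [in RHS](bigD1 (-1)) //=.
  rewrite [1 + _]addrC addrK (bigD1 (-1)) //= eqxx add0r.
  by apply: eq_bigr => t /andP[_ ->].
rewrite subr0 -sum_K1; apply: eq_bigr => t tK.
by case: eqP K1' => // <-; rewrite tK.
Qed.

End CyclotomicSums.

(** * Powers of a generator and the cosets of [powK F ell] *)

Section PowerResidueClasses.

Variables (F : finFieldType) (g : {unit F}) (ell : nat).

Hypothesis F_odd : odd #|F|.
Hypothesis ell_dvd : (ell %| #|F|.-1)%N.
Hypothesis g_gen : generator [set: {unit F}] g.

Lemma g_order : #[g]%g = #|F|.-1.
Proof. by rewrite -card_finField_unit orderE -(eqP g_gen). Qed.

Lemma g_powers (x : F) : x != 0 -> exists m, x = val g ^+ m.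
Proof.
move=> x0; have ux : x \is a GRing.unit by rewrite unitfE.
have : FinRing.Unit ux \in <[g]>%g by rewrite -(eqP g_gen) inE.
by case/cycleP => m /(congr1 val) /= ->; exists m; rewrite FinRing.val_unitX.
Qed.

Lemma val_g_neq0 : val g != 0.
Proof. by rewrite -unitfE (valP g). Qed.

(** Exponents matter only modulo the order of [g], and [ell] divides that order, so divisibility by
    [ell] does not depend on the exponent chosen. *)
Lemma expr_in_powK m : (val g ^+ m \in powK F ell) = (ell %| m)%N.
Proof.
apply/imsetP/dvdnP => [[y]|[t ->]]; last first.
  by exists (val g ^+ t); rewrite ?exprM // inE expf_neq0 // val_g_neq0.
rewrite inE => /g_powers[s ->]; rewrite -exprM -!FinRing.val_unitX.
move/val_inj/eqP; rewrite eq_expg_mod_order g_order => E.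
apply/dvdnP; rewrite /dvdn -(modn_dvdm m ell_dvd) (eqP E) modn_dvdm //.
by rewrite modnMl.
Qed.

Lemma powK0 : 0 \notin powK F ell.
Proof.
apply/imsetP => -[y y0] /eqP; rewrite eq_sym expf_eq0 => /andP[_ /eqP yE].
by rewrite inE yE eqxx in y0.
Qed.

Lemma powK1 : 1 \in powK F ell.
Proof. by apply/imsetP; exists 1; rewrite ?expr1n // inE oner_neq0. Qed.

Lemma powKM x y : x \in powK F ell -> (x * y \in powK F ell) = (y \in powK F ell).
Proof.
case/imsetP => a a0 ->; rewrite inE in a0.
apply/imsetP/imsetP => -[b b0 E]; rewrite inE in b0.
  exists (b / a); first by rewrite inE mulf_neq0 ?invr_eq0.
  by rewrite expr_div_n -E mulrAC divff ?mul1r // expf_neq0.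
by exists (a * b); rewrite ?exprMn ?E // inE mulf_neq0.
Qed.

(** The square is 1 because [#|F|.-1] is even; the element itself is not 1 because its exponent is
    positive and below the order of [g]. *)
Lemma expr_half_order : val g ^+ (#|F|.-1)./2 = -1.
Proof.
have F_gt1 : (1 < #|F|)%N := card_finNzRing_gt1 F.
have sqr1 : (val g ^+ (#|F|.-1)./2) ^+ 2 == 1.
  rewrite -exprM (_ : _ * 2 = #[g]%g)%N; last by rewrite g_order; lia.
  by rewrite -FinRing.val_unitX expg_order.
case/orP: (etrans (esym (sqrf_eq1 _)) sqr1) => [/eqP E|/eqP //].
have : (#[g]%g %| (#|F|.-1)./2)%N.
  by rewrite order_dvdn; apply/eqP/val_inj; rewrite FinRing.val_unitX.
by rewrite g_order => /dvdn_leq; lia.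
Qed.

Lemma powK_classes x : (0 < ell)%N -> x != 0 ->
  exists2 i, (i < ell)%N &
    forall j, (j < ell)%N -> (x / val g ^+ j \in powK F ell) = (j == i).
Proof.
move=> ell_gt0 /g_powers[m ->]; exists (m %% ell)%N; first by rewrite ltn_mod.
(* Adding [#[g]%g * ell] changes neither the power of [g] nor the residue modulo [ell], and keeps
   the truncated subtraction of [j] exact. *)
move=> j lt_j; have jm : (j <= m + #[g]%g * ell)%N.
  by rewrite (leq_trans (ltnW lt_j)) // (leq_trans _ (leq_addl _ _)) // leq_pmull.
have -> : val g ^+ m / val g ^+ j = val g ^+ (m + #[g]%g * ell - j).
  rewrite expfB_cond ?(negPf val_g_neq0) // exprD exprM.
  by rewrite -[val g ^+ #[g]%g]FinRing.val_unitX expg_order expr1n mulr1.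
by rewrite expr_in_powK -eqn_mod_dvd // addnC modnMDl (modn_small lt_j) eq_sym.
Qed.

(** By [expr_half_order] the shift by half the order is a change of sign; an element [y] of the
    intersection is then indexed by [a = 1 - y]. *)
Lemma cyclotomic_number_sum (R : nzSemiRingType) (i j : nat) :
  (cyclotomic_number ell (val g) (i%:Z + ((#|F|.-1)./2)%:Z) j%:Z)%:R =
  \sum_a (a / val g ^+ i \in powK F ell)%:R *
         ((1 - a) / val g ^+ j \in powK F ell)%:R :> R.
Proof.
have coset (c z y : F) : c != 0 ->
    (y \in [set z + c * x | x in powK F ell]) = ((y - z) / c \in powK F ell).
  move=> c0; apply/imsetP/idP => [[x xK ->]|yK].
    by rewrite [z + _]addrC addrK mulrAC divff ?mul1r.
  by exists ((y - z) / c); rewrite // mulrC divfK // addrC subrK.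
have gm0 m : val g ^+ m != 0 by rewrite expf_neq0 ?val_g_neq0.
rewrite /cyclotomic_number -PoszD -!exprnP exprD expr_half_order mulrN1.
have -> : [set val g ^+ j * x | x in powK F ell] =
    [set 0 + val g ^+ j * x | x in powK F ell].
  by apply: eq_imset => x; rewrite add0r.
rewrite -sum1_card natr_sum big_mkcond (reindex_inj (inv_inj (subKr 1))) /=.
apply: eq_bigr => a _; rewrite inE !coset ?oppr_eq0 // subr0.
rewrite [1 - a]addrC addrK invrN mulrNN; do 2 case: (_ \in _);
  by rewrite ?mulr1 ?mulr0.
Qed.

End PowerResidueClasses.

(** * The spectral theorem for cyclotomic matrices of difference sets *)

(** The case [ell = 2] is stated apart for the minimal polynomials: there [rho] and [- rho] have
    multiplicity 0, so the factor ['X^2 - (kR - lR)%:P] drops out. *)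
Theorem theorem3 (R : rcfType) (F : finFieldType) (g : {unit F})
    (n k lambda : nat) :
  let ell := n.+2 in
  odd #|F| ->
  (ell %| #|F|.-1)%N ->
  generator [set: {unit F}] g ->
  difference_set (powK F ell) k lambda ->
  let M : 'M[R]_n.+2 := cyclotomic_mx R ell (val g) in
  let S : 'M[R]_n.+1 := row' ord0 (col' ord0 M) in
  let kR : R := k%:R in
  let lR : R := lambda%:R in
  let rho : R := Num.sqrt (kR - lR) in
  let delta : R := Num.sqrt (kR ^+ 2 - 4 * lR) in
  [/\ has_spectrum M
        [:: (((kR + delta) / 2)%:C, 1%N);
            (((kR - delta) / 2)%:C, 1%N);
            (rho%:C, (ell./2 - 1)%N);
            ((- rho)%:C, (ell./2 - 1)%N)],
      has_spectrum S
        [:: ((kR - lR)%:C, 1%N);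
            (rho%:C, (ell./2 - 1)%N);
            ((- rho)%:C, (ell./2 - 1)%N)],
      forall a : R, a = rho \/ a = - rho ->
        (forall v : 'cV[R]_(1 + n.+1), is_eigenvector M a v <->
           exists w : 'cV[R]_n.+1,
             [/\ v = col_mx 0 w, \sum_i w i 0 = 0 & is_eigenvector S a w]) /\
        (forall w : 'cV[R]_n.+1, is_eigenvector S a w -> \sum_i w i 0 = 0),
      (2 < ell)%N ->
        mxminpoly M =
          ('X^2 - kR%:P * 'X + lR%:P) * ('X^2 - (kR - lR)%:P) /\
        mxminpoly S = ('X - (kR - lR)%:P) * ('X^2 - (kR - lR)%:P) &
      ell = 2%N ->
        mxminpoly M = 'X^2 - kR%:P * 'X + lR%:P /\
        mxminpoly S = 'X - (kR - lR)%:P].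
Proof.
move=> ell F_odd ell_dvd g_gen KD M S kR lR rho delta.
pose r (i : 'I_n.+2) := val g ^+ i.
have r0 : r ord0 = 1 by [].
have r_neq0 i : r i != 0 by rewrite expf_neq0 ?val_g_neq0.
have rP x : x != 0 -> exists i, forall j, (x / r j \in powK F ell) = (j == i).
  move=> x0; have [i lt_i iP] := powK_classes ell_dvd g_gen (ltn0Sn _) x0.
  by exists (Ordinal lt_i) => j; rewrite iP.
have ME i j : M i j = \sum_a (a / r i \in powK F ell)%:R *
                             ((1 - a) / r j \in powK F ell)%:R.
  by rewrite mxE cyclotomic_number_sum.
have K0 := powK0 F ell; have K1 := powK1 F ell; have KM := @powKM F ell.
have kE : k = (1 + lambda * n.+2)%N := difference_set_card K0 K1 KM r0 r_neq0 rP KD ME.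
have lam_gt0 : (0 < lambda)%N by case: KD.
have Mr0 j : M 0 j = lR := cyclotomic_row0 K0 K1 KM r0 r_neq0 KD ME j.
have Mc0 i : M i 0 = lR by rewrite (cyclotomic_sym ME).
have Mu : M *m const_mx 1 = kR *: const_mx 1 - delta_mx 0 0 :> 'cV_n.+2.
  apply/matrixP=> i j; rewrite !mxE (ord1 j) andbT mulr1.
  rewrite -(cyclotomic_row_sum K0 K1 r0 r_neq0 rP KD ME i).
  by apply: eq_bigr => l _; rewrite [const_mx _ _ _]mxE mulr1.
have MM : M *m M = (kR - lR)%:M +
    (lR * kR) *: (const_mx 1 *m (const_mx 1 : 'cV_n.+2)^T) -
    kR *: (delta_mx 0 0 *m (delta_mx 0 0 : 'cV_n.+2)^T).
  apply/matrixP=> i j; rewrite mxE.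
  rewrite (cyclotomic_sqr_entry K0 K1 KM r0 r_neq0 rP KD ME) !mxE !big_ord1 !mxE.
  by rewrite !andbT !mulr1; congr (_ - _); rewrite -natrM mulnb mulr_natr.
have trM := cyclotomic_trace K0 KM r_neq0 rP KD ME.
have b_le1 (b : bool) : (b <= 1)%N by case: b.
have half : (ell./2 - 1 = n./2)%N by rewrite subn1.
(* In both spectra [b] is the truth value of [-1 \in powK F ell]. *)
have [specM minM minM2] := M_spectrum lam_gt0 kE Mc0 Mu MM (b_le1 _) trM.
have [specS minS minS2] := S_spectrum lam_gt0 kE Mr0 Mc0 Mu MM (b_le1 _) trM.
rewrite half; split=> // [a a_rho|n_gt0|[n0]]; last 2 first.
- by split; [apply: minM|apply: minS]; rewrite -(ltn_add2l 2).
- by split; [apply: minM2|apply: minS2].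
have ac : a ^+ 2 = kR - lR.
  by case: a_rho => ->; rewrite ?sqrrN; apply: rho_sqr lam_gt0 kE.
split=> [v|w].
  exact (M_eigenvectorE lam_gt0 kE Mr0 Mc0 MM v ac).
exact (S_eigenvector_sum lam_gt0 kE Mr0 Mc0 MM ac).
Qed.
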